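(* Let $L$ be a quantale and let $a\in L$. The following are equivalent: (1) $a$ is a $\mu$-element; (2) for every $y,z\in L$ such that $y\wedge z\neq 0$, the conditions $a\wedge y\neq 0$ and $a\wedge z\neq 0$ imply that $a\wedge(y\wedge z)\neq 0$.
   Context: A quantale here means an integral commutative quantale: a complete lattice $(L,\leqslant,0,1)$ with an associative, commutative multiplication distributing over arbitrary joins and having the top element $1$ as multiplicative identity. An element $x\in L$ is a $\mu$-element if for every natural number $n\geqslant 2$ and all $y_1,\ldots,y_n\in L$ with $\bigwedge_{k=1}^n y_k\neq 0$, the condition $x\wedge y_k\neq 0$ for every $k$ implies $x\wedge\bigl(\bigwedge_{k=1}^n y_k\bigr)\neq 0$. *)

(* Defs.v *)
From HB Require Import structures.
From mathcomp Require Import all_boot all_order.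
From mathcomp Require Import boolp classical_sets.

Set Implicit Arguments.
Unset Strict Implicit.
Unset Printing Implicit Defensive.

Local Open Scope classical_set_scope.
Local Open Scope order_scope.

(* The bounds \bot, \top and the binary meet and join are those of the
   underlying bounded lattice; completeness adds the join of every subset. *)
HB.mixin Record isCompleteLattice d L of Order.TBLattice d L := {
  bigsup : set L -> L;
  bigsupP : forall A : set L, supremums A (bigsup A)
}.

#[short(type="completeLatticeType")]
HB.structure Definition CompleteLattice d :=
  { L of Order.TBLattice d L & isCompleteLattice d L }.

(* Integral commutative quantales: the multiplicative identity is the top. *)
HB.mixin Record isQuantale d L of CompleteLattice d L := {
  qmul : L -> L -> L;
  qmulA : associative qmul;
  qmulC : commutative qmul;
  qmul1x : left_id (\top : L) qmul;
  qmul_bigsupr : forall (x : L) (A : set L),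
    qmul x (bigsup A) = bigsup [set qmul x y | y in A]
}.

#[short(type="quantaleType")]
HB.structure Definition Quantale d :=
  { L of CompleteLattice d L & isQuantale d L }.

Definition mu_element d (L : quantaleType d) (x : L) : Prop :=
  forall (n : nat) (y : 'I_n -> L), (2 <= n)%N ->
    \meet_(k < n) y k != \bot ->
    (forall k : 'I_n, x `&` y k != \bot) ->
    x `&` \meet_(k < n) y k != \bot.

(* Main.v *)
Require Import Defs.
From mathcomp Require Import all_boot all_order.

Import Order.TTheory.

Local Open Scope order_scope.

(** The binary condition is the case [n = 2]. Conversely, it gives all finite meets by induction,
    splitting off one factor at a time: the tail of a nonzero meet is again nonzero. *)

Theorem proposition3p6 (d : Order.disp_t) (L : quantaleType d) (a : L) :
  mu_element a <->
  (forall y z : L, y `&` z != \bot ->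
     a `&` y != \bot -> a `&` z != \bot ->
     a `&` (y `&` z) != \bot).
Proof.
split=> [mu_a y z yz ay az | binary [//|n] y _].
  have meet2 : \meet_(k < 2) (if k == ord0 then y else z) = y `&` z.
    by rewrite big_ord_recl big_ord1.
  rewrite -meet2; apply: mu_a => //; first by rewrite meet2.
  by move=> k; case: ifP.
(* The family now has [n.+1] members, so the induction starts at a single element, where the
   conclusion is itself a hypothesis. *)
elim: n y => [|n IHn] y; first by rewrite big_ord1 => _; apply.
rewrite big_ord_recl => meet_y ay; apply: binary => //.
apply: IHn => //.
(* A zero tail would make the whole meet zero. *)
by apply: contraNneq meet_y => ->; rewrite meetx0.
Qed.
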